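(* Let $\Sigma$ be a co-dimension one brane (a hypersurface) in a bulk $(\mathcal{M},g)$, with induced metric (first fundamental form) $h$ and normal one-form $\boldsymbol N$. At any point $p\in\Sigma_0$ (and therefore at all points of the signature-changing set $S$ of $\Sigma$), $h|_p$ has a unique degeneration direction, given by $\vec N|_p$; that is, $\vec N|_p$ is tangent to $\Sigma$ and the set of vectors $\vec v\in T_p\Sigma$ with $h|_p(\vec v,\cdot)=0$ is exactly the line spanned by $\vec N|_p$.
   Context: The bulk $(\mathcal{M},g)$ is a $C^3$ manifold with a continuous Lorentzian metric $g$ of signature $(-,+,\dots,+)$, and $\Sigma$ is a $C^3$ hypersurface of arbitrary, possibly varying, causal character. $\boldsymbol N$ is a nowhere zero one-form along $\Sigma$ with $\boldsymbol N(\vec v)=0$ for all $\vec v$ tangent to $\Sigma$, and $\vec N$ is the vector field obtained by raising its index with $g$. With $(\boldsymbol N,\boldsymbol N)=g^{\mu\nu}N_\mu N_\nu$, let $\Sigma_E$, $\Sigma_0$, $\Sigma_L$ be the subsets of $\Sigma$ where $(\boldsymbol N,\boldsymbol N)<0$, $=0$, $>0$ respectively. The signature-changing set is $S=(\overline{\Sigma_L}\cap\Sigma_0)\cup(\overline{\Sigma_E}\cap\Sigma_0)\subset\Sigma_0$. *)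

(* Defs.v *)
From HB Require Import structures.
From mathcomp Require Import all_boot all_order all_algebra.
From mathcomp Require Import all_classical all_reals all_analysis.

Set Implicit Arguments.
Unset Strict Implicit.
Unset Printing Implicit Defensive.

Import Order.TTheory GRing.Theory Num.Theory.
Import numFieldNormedType.Exports.
Local Open Scope classical_set_scope.
Local Open Scope ring_scope.

(* [f] is of class C^k on the open set [U]: Frechet differentiability, and all
   directional derivatives ['d f _ v] of class C^(k-1).  As the spaces are
   finite-dimensional, this is the same as the differential being C^(k-1). *)
Fixpoint Ck (R : realType) (m n : nat) (k : nat) (U : set 'rV[R]_m.+1)
    (f : 'rV[R]_m.+1 -> 'rV[R]_n.+1) : Prop :=
  match k with
  | 0 => forall x, U x -> {for x, continuous f}
  | k'.+1 => (forall x, U x -> differentiable f x) /\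
             (forall v, Ck k' U (fun x => 'd f x v))
  end.

(* The values of [chart_map] outside [chart_dom], and those of [chart_inv]
   outside the image of [chart_dom], are irrelevant. *)
Record chart (R : realType) (n : nat) (T : topologicalType) := Chart {
  chart_dom : set T;
  chart_map :> T -> 'rV[R]_n.+1;
  chart_inv : 'rV[R]_n.+1 -> T;
  chart_dom_open : open chart_dom;
  chart_img_open : open (chart_map @` chart_dom);
  chart_mapK : forall p, chart_dom p -> chart_inv (chart_map p) = p;
  chart_map_continuous : forall p, chart_dom p -> {for p, continuous chart_map};
  chart_inv_continuous : forall x, (chart_map @` chart_dom) x ->
    {for x, continuous chart_inv}
}.

Section Atlas.
Context {R : realType} {n : nat} {T : topologicalType}.
Implicit Types c d : chart R n T.

Definition transition c d : 'rV[R]_n.+1 -> 'rV[R]_n.+1 :=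
  fun x => d (chart_inv c x).

Definition C3_transition c d : Prop :=
  Ck 3 (c @` (chart_dom c `&` chart_dom d)) (transition c d).

Definition C3_compatible c d : Prop := C3_transition c d /\ C3_transition d c.

End Atlas.

(* The dimension is n + 1.  The atlas is required to be maximal, so that its
   elements are all the C^3 coordinate systems. *)
Record C3_manifold (R : realType) (n : nat) := C3Manifold {
  carrier :> topologicalType;
  manifold_hausdorff : hausdorff_space carrier;
  manifold_second_countable : @second_countable carrier;
  atlas : set (chart R n carrier);
  atlas_cover : forall p : carrier, exists2 c, atlas c & chart_dom c p;
  atlas_compatible : forall c d, atlas c -> atlas d -> C3_compatible c d;
  atlas_maximal : forall c,
    (forall d, atlas d -> C3_compatible c d) -> atlas c
}.

Lemma transition_differentiable (R : realType) (n : nat) (M : C3_manifold R n)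
    (c d : chart R n M) (p : M) : atlas c -> atlas d ->
  chart_dom c p -> chart_dom d p -> differentiable (transition c d) (c p).
Proof.
move=> Ac Ad cp dp; have [[+ _] _] := atlas_compatible Ac Ad.
by apply; exists p.
Qed.

Lemma near_eq_is_diff (R : realType) (V W : normedModType R) (f g : V -> W)
    (x : V) : {near x, f =1 g} -> differentiable f x ->
  differentiable g x /\ 'd g x = 'd f x :> (V -> W).
Proof.
move=> fg df; have fgx : f x = g x := nbhs_singleton fg.
have cdf : continuous ('d f x) by exact: diff_continuous.
have gE : g \o shift x = cst (g x) + 'd f x +o_ (0 : V) id.
  apply/eqaddoP => _/posnumP[e].
  have := diff_locally df => /eqaddoP /(_ e%:num (gt0 e)) H.
  have fg0 : \forall h \near (0 : V), f (h + x) = g (h + x).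
    by have := fg; rewrite (near_shift 0 x) subr0; apply: filterS => h.
  by apply: filterS2 fg0 H => h E; rewrite !fctE /= E fgx.
have dE := diff_unique cdf gE.
by split => //; apply/diff_locallyP; rewrite dE.
Qed.

Lemma transition_comp (R : realType) (n : nat) (M : C3_manifold R n)
    (c d e : chart R n M) (p : M) (x : 'rV[R]_n.+1) :
  atlas c -> atlas d -> atlas e ->
  chart_dom c p -> chart_dom d p -> chart_dom e p ->
  'd (transition c e) (c p) x =
  'd (transition d e) (d p) ('d (transition c d) (c p) x).
Proof.
move=> Ac Ad Ae cp dp ep.
have cd := transition_differentiable Ac Ad cp dp.
have ce := transition_differentiable Ac Ae cp ep.
have de : differentiable (transition d e) (transition c d (c p)).
  by rewrite /transition chart_mapK//; exact: transition_differentiable.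
have near_d : \forall y \near c p, chart_dom d (chart_inv c y).
  have /(_ (chart_dom d)) := chart_inv_continuous (ex_intro2 _ _ p cp erefl).
  apply; rewrite chart_mapK//.
  exact: open_nbhs_nbhs (conj (chart_dom_open d) dp).
have nce : {near c p, transition c e =1 transition d e \o transition c d}.
  by apply: filterS near_d => y dy; rewrite /= /transition chart_mapK.
have [_ E] := near_eq_is_diff nce ce.
have dp' : transition c d (c p) = d p by rewrite /transition chart_mapK.
have cde := diff_comp cd de.
rewrite dp' in cde.
exact: (congr1 (fun h => h x) (etrans (esym E) cde)).
Qed.

Definition coords (R : realType) (n : nat) (M : C3_manifold R n) : Type :=
  {c : chart R n M | atlas c}.

Definition chart_of (R : realType) (n : nat) (M : C3_manifold R n)
  (c : coords M) : chart R n M := sval c.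
Coercion chart_of : coords >-> chart.

Section TangentSpace.
Context {R : realType} {n : nat} {M : C3_manifold R n}.

Local Notation coords := (coords M).

(* A tangent vector at [p] is the family of its components in all the charts
   around [p], subject to the usual transformation law; charts that do not
   contain [p] are given the dummy component 0. *)
Definition is_tangent (p : M) (v : coords -> 'rV[R]_n.+1) : Prop :=
  (forall c : coords, ~ chart_dom c p -> v c = 0) /\
  (forall c d : coords, chart_dom c p -> chart_dom d p ->
     v d = 'd (transition c d) (c p) (v c)).

Definition tangent_pred (p : M) : {pred coords -> 'rV[R]_n.+1} :=
  fun v => `[< is_tangent p v >].

Lemma tangent_submod_closed (p : M) : submod_closed (tangent_pred p).
Proof.
split=> [|a u v /asboolP[u0 uT] /asboolP[v0 vT]]; apply/asboolP; split => //.
- by move=> c d _ _; rewrite linear0.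
- by move=> c cp; rewrite !fctE u0// v0// scaler0 addr0.
- by move=> c d cp dp; rewrite !fctE linearD linearZ /= -uT// -vT.
Qed.

HB.instance Definition _ (p : M) :=
  GRing.isSubmodClosed.Build R (coords -> 'rV[R]_n.+1) (tangent_pred p)
    (tangent_submod_closed p).

Record tangent (p : M) := Tangent {
  tcomp :> coords -> 'rV[R]_n.+1;
  tcompP : tcomp \in tangent_pred p
}.

HB.instance Definition _ (p : M) := [isSub for @tcomp p].
HB.instance Definition _ (p : M) := [Choice of tangent p by <:].
HB.instance Definition _ (p : M) :=
  [SubChoice_isSubLmodule of tangent p by <:].

(* [coord_vec c p i] is the coordinate vector d/dx^i at [p] of the chart [c];
   it is 0 if [p] is not in the domain of [c]. *)
Definition coord_comp (c : coords) (p : M) (i : 'I_n.+1) :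
    coords -> 'rV[R]_n.+1 :=
  fun d => if `[< chart_dom c p /\ chart_dom d p >]
           then 'd (transition c d) (c p) (delta_mx 0 i) else 0.

Lemma coord_compP c p i : coord_comp c p i \in tangent_pred p.
Proof.
apply/asboolP; split=> [d dp|d e dp ep]; rewrite /coord_comp.
  by case: asboolP => // -[].
have [cp|cp] := pselect (chart_dom c p); last first.
  by do 2![case: asboolP => [[//]|_]]; rewrite linear0.
rewrite !asboolT//; apply: transition_comp => //; exact: svalP.
Qed.

Definition coord_vec (c : coords) (p : M) (i : 'I_n.+1) : tangent p :=
  Tangent (coord_compP c p i).

End TangentSpace.

Definition gram (R : realType) (n : nat) (M : C3_manifold R n)
    (g : forall p : M, tangent p -> tangent p -> R) (c : coords M) (p : M) :
    'M[R]_n.+1 :=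
  \matrix_(i, j) g p (coord_vec c p i) (coord_vec c p j).

(* Lorentzian signature (-,+,...,+) is expressed by the existence of a
   pseudo-orthonormal frame; n + 1 such vectors are automatically a basis of
   the (n + 1)-dimensional tangent space. *)
Record lorentzian_metric (R : realType) (n : nat) (M : C3_manifold R n) :=
  LorentzianMetric {
  metric :> forall p : M, tangent p -> tangent p -> R;
  metric_scalar : forall (p : M) (u : tangent p), scalar (metric u);
  metric_sym : forall (p : M) (u v : tangent p), metric u v = metric v u;
  metric_signature : forall p : M, exists e : 'I_n.+1 -> tangent p,
    forall i j, metric (e i) (e j) =
      if i == j then (if i == ord0 then -1 else 1) else 0;
  metric_continuous : forall (c : coords M) (i j : 'I_n.+1) (p : M),
    chart_dom c p -> {for p, continuous (fun q => gram metric c q i j)}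
}.

Arguments metric {R n M} _ p u v.

Section Hypersurface.
Context {R : realType} {n : nat} {M : C3_manifold R n}.
Implicit Types (g : lorentzian_metric M) (Sigma : set M).

(* Embedded C^3 submanifold of codimension one, by slice charts. *)
Definition hypersurface Sigma : Prop :=
  forall p, Sigma p -> exists2 c : coords M, chart_dom c p &
    forall q, chart_dom c q -> (Sigma q <-> c q 0 ord_max = 0).

(* T_p Sigma: velocities at [p] of the curves lying in [Sigma]. *)
Definition tangent_to Sigma (p : M) : set (tangent p) :=
  [set v | exists gamma : R -> M,
    [/\ gamma 0 = p, {for 0, continuous gamma},
        \forall t \near 0, Sigma (gamma t) &
        forall c : coords M, chart_dom c p ->
          is_derive (0 : R) (1 : R) (fun t => c (gamma t)) (tcomp v c)]].

Arguments tangent_to : clear implicits.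

Definition first_fundamental_form g Sigma (p : M)
    (v w : tangent_to Sigma p) : R :=
  g p (val v) (val w).

Lemma chart_at_subproof (p : M) : exists c : coords M, chart_dom c p.
Proof. by have [c Ac cp] := atlas_cover p; exists (exist _ c Ac). Qed.

(* A chosen chart around [p], used to write down tensorial (hence
   chart-independent) expressions. *)
Definition chart_at (p : M) : coords M := sval (cid (chart_at_subproof p)).

Definition coordinate_vec (p : M) (i : 'I_n.+1) : tangent p :=
  coord_vec (chart_at p) p i.

Definition inverse_metric g (p : M) : 'M[R]_n.+1 :=
  invmx (gram g (chart_at p) p).

(* The vector g^{mu nu} a_nu d/dx^mu. *)
Definition raise g (p : M) (a : {scalar tangent p}) : tangent p :=
  \sum_mu (\sum_nu inverse_metric g p mu nu * a (coordinate_vec p nu))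
    *: coordinate_vec p mu.

(* The scalar product g^{mu nu} a_mu b_nu of two one-forms at [p]. *)
Definition form_product g (p : M) (a b : {scalar tangent p}) : R :=
  \sum_mu \sum_nu inverse_metric g p mu nu *
    a (coordinate_vec p mu) * b (coordinate_vec p nu).

(* One-forms along Sigma are represented by families indexed by all of [M];
   their values off [Sigma] are irrelevant. *)
Implicit Types N : forall p : M, {scalar tangent p}.

Definition normal_form Sigma N : Prop := forall p, Sigma p ->
  (exists v, N p v != 0) /\ (forall v, tangent_to Sigma p v -> N p v = 0).

Definition Sigma_E g Sigma N : set M :=
  [set p | Sigma p /\ form_product g (N p) (N p) < 0].

Definition Sigma_0 g Sigma N : set M :=
  [set p | Sigma p /\ form_product g (N p) (N p) = 0].

Definition Sigma_L g Sigma N : set M :=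
  [set p | Sigma p /\ form_product g (N p) (N p) > 0].

(* Both closures are intersected with a subset of [Sigma], so that it does not
   matter whether they are taken in [M] or in [Sigma]. *)
Definition signature_changing g Sigma N : set M :=
  (closure (Sigma_L g Sigma N) `&` Sigma_0 g Sigma N) `|`
  (closure (Sigma_E g Sigma N) `&` Sigma_0 g Sigma N).

Definition degeneration_vectors g Sigma (p : M) : set (tangent_to Sigma p) :=
  [set v | forall w, first_fundamental_form g v w = 0].

Arguments degeneration_vectors : clear implicits.

(* [x] is a nonzero vector tangent to [Sigma], and the degeneration vectors of
   the first fundamental form are exactly the multiples of [x]. *)
Definition unique_degeneration_direction g Sigma (p : M) (x : tangent p) :
    Prop :=
  [/\ x != 0, tangent_to Sigma p x &
      [set val v | v in degeneration_vectors g Sigma p] =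
      [set a *: x | a in [set: R]]].

End Hypersurface.

(* Main.v *)
(* Raising the index means g(raise N, v) = N v.  In a slice chart, coordinate
   lines show that every vector with vanishing last component is tangent to
   Sigma; as N is nonzero, T_p Sigma is therefore exactly ker N.  At p in
   Sigma_0, N (raise N) = (N, N) = 0, so raise N is tangent and g-orthogonal to
   T_p Sigma.  Conversely, if g(v, .) vanishes on ker N, it is a multiple of N,
   so v is a multiple of raise N because g is nondegenerate. *)

Require Import Defs.
From HB Require Import structures.
From mathcomp Require Import all_boot all_order all_algebra.
From mathcomp Require Import all_classical all_reals all_analysis.

Set Implicit Arguments.
Unset Strict Implicit.
Unset Printing Implicit Defensive.

Import Order.TTheory GRing.Theory Num.Theory.
Import numFieldNormedType.Exports.
Local Open Scope classical_set_scope.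
Local Open Scope ring_scope.

(** This serves to differentiate curves that run along a coordinate line; the two difference
    quotients are the same function of [h]. *)
Lemma is_derive_line (R : numFieldType) (V W : normedModType R) (f : V -> W)
    (x v : V) (df : W) :
  is_derive x v f df -> is_derive (0 : R) (1 : R) (fun t => f (t *: v + x)) df.
Proof.
move=> [fxv <-]; apply: DeriveDef; first by have /derivable1P := fxv.
rewrite /derive; set u := fun h => h^-1 *: _; set w := fun h => h^-1 *: _.
suff -> : u = w by [].
by apply/funext => h; rewrite /u /w /= addr0 scale0r add0r [_%:A]mulr1.
Qed.

Section Components.
Context {R : realType} {n : nat} {M : C3_manifold R n}.
Implicit Types (c d : coords M) (p : M).

Lemma chart_image_nbhs c p : chart_dom c p ->
  \forall y \near (c p : 'rV[R]_n.+1), (c @` chart_dom c) y.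
Proof.
move=> cp; apply: open_nbhs_nbhs; split; first exact: chart_img_open.
by exists p.
Qed.

(** [transition c c] is known to be the identity only on the image of the chart, but that image is
    open, so the two maps agree near [c p]. *)
Lemma diff_transition_id c p (x : 'rV[R]_n.+1) : chart_dom c p ->
  'd (transition c c) (c p) x = x.
Proof.
move=> cp.
have near_id : {near (c p : 'rV[R]_n.+1), id =1 transition c c}.
  apply: filterS (chart_image_nbhs cp) => _ [q cq <-].
  by rewrite /transition chart_mapK.
have id_diff := is_diff_id (c p : 'rV[R]_n.+1).
have [_ ->] := near_eq_is_diff near_id (@ex_diff _ _ _ _ _ _ _ id_diff).
by rewrite diff_val.
Qed.

Lemma tcomp_transition p (v : tangent p) c d :
  chart_dom c p -> chart_dom d p ->
  tcomp v d = 'd (transition c d) (c p) (tcomp v c).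
Proof. by case: v => v /= /asboolP[_]; apply. Qed.

(** The transformation law recovers the component in every other chart around [p]; the remaining
    charts carry the dummy value 0. *)
Lemma tangent_inj p (u v : tangent p) c :
  chart_dom c p -> tcomp u c = tcomp v c -> u = v.
Proof.
move=> cp uv; apply: val_inj; apply/funext => d /=.
have [dp|dp] := pselect (chart_dom d p).
  by rewrite !(tcomp_transition _ cp dp) uv.
case: u v {uv} => [u /= /asboolP[u0 _]] [v /= /asboolP[v0 _]].
by rewrite u0 ?v0.
Qed.

Lemma tcompZ p a (u : tangent p) c : tcomp (a *: u) c = a *: tcomp u c.
Proof. by []. Qed.

Lemma tcomp_sum p (I : finType) (F : I -> tangent p) c :
  tcomp (\sum_i F i) c = \sum_i tcomp (F i) c.
Proof. by apply: (big_morph (fun v : tangent p => tcomp v c)). Qed.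

Lemma tcomp_coord_vec c p i : chart_dom c p ->
  tcomp (coord_vec c p i) c = delta_mx 0 i.
Proof. by move=> cp; rewrite /= /coord_comp asboolT// diff_transition_id. Qed.

Lemma tangentE c p (v : tangent p) : chart_dom c p ->
  v = \sum_i tcomp v c 0 i *: coord_vec c p i.
Proof.
move=> cp; apply: (tangent_inj cp); rewrite tcomp_sum [LHS]row_sum_delta.
by apply: eq_bigr => i _; rewrite tcompZ tcomp_coord_vec.
Qed.

Lemma chart_at_dom p : chart_dom (chart_at p) p.
Proof. exact: svalP (cid (chart_at_subproof p)). Qed.

End Components.

Section Musical.
Context {R : realType} {n : nat} {M : C3_manifold R n}.
Variables (g : lorentzian_metric M) (p : M).
Implicit Types (u v : tangent p) (a : {scalar tangent p}).

(** This makes linearity available in the second argument of [g]; the first argument is reached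
    through symmetry. *)
HB.instance Definition _ u :=
  GRing.isLinear.Build R (tangent p) R *%R (g p u) (metric_scalar g u).

Lemma metric_linear_suml (I : finType) (a : I -> R) (F : I -> tangent p) v :
  g p (\sum_i a i *: F i) v = \sum_i a i * g p (F i) v.
Proof.
rewrite Defs.metric_sym linear_sum; apply: eq_bigr => i _.
by rewrite linearZ /= Defs.metric_sym.
Qed.

Lemma metric_gram (c : coords M) u v : chart_dom c p ->
  (tcomp u c *m gram g c p *m (tcomp v c)^T) 0 0 = g p u v.
Proof.
move=> cp; rewrite [in RHS](tangentE v cp) linear_sum mxE.
apply: eq_bigr => j _; rewrite linearZ /= mulrC !mxE; congr (_ * _).
rewrite [in RHS](tangentE u cp) metric_linear_suml.
by apply: eq_bigr => i _; rewrite mxE.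
Qed.

(** Writing the pseudo-orthonormal frame in the chart as the rows of [E] gives [E G E^T = eta], the
    Minkowski matrix. As [eta] is invertible, so is each square factor. *)
Lemma gram_unit (c : coords M) : chart_dom c p -> gram g c p \in unitmx.
Proof.
move=> cp; have [e eE] := metric_signature g p.
pose E := \matrix_i tcomp (e i) c.
pose eta : 'M[R]_n.+1 := diag_mx (\row_i (if i == ord0 then -1 else 1)).
have GE : E *m gram g c p *m E^T = eta.
  apply/matrixP => i j; rewrite [RHS]mxE mxE.
  transitivity (g p (e i) (e j)).
    rewrite -(metric_gram _ _ cp) mxE; apply: eq_bigr => k _.
    rewrite !mxE; congr (_ * _).
    by apply: eq_bigr => l _; rewrite !mxE.
  by rewrite eE; case: eqP => [->|]; rewrite ?mxE.
have : eta \in unitmx.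
  rewrite unitmxE det_diag unitfE; apply/prodf_neq0 => i _.
  by rewrite mxE; case: ifP; rewrite ?oppr_eq0 oner_eq0.
by rewrite -GE !unitmx_mul => /andP[/andP[]].
Qed.

Lemma metric_raise a v : g p (raise g a) v = a v.
Proof.
have cp := chart_at_dom p.
rewrite (tangentE v cp) !linear_sum; apply: eq_bigr => j _.
rewrite !linearZ /=; congr (_ * _).
rewrite /raise metric_linear_suml.
under eq_bigr do rewrite mulr_suml.
rewrite exchange_big /=.
(* By symmetry of [g] this sum is an entry of the Gram matrix times its inverse. *)
have VG k : \sum_i inverse_metric g p i k *
    g p (coordinate_vec p i) (coordinate_vec p j) = (j == k)%:R.
  have := mulmxV (gram_unit cp) => /matrixP/(_ j k); rewrite !mxE => <-.
  by apply: eq_bigr => i _; rewrite mulrC mxE Defs.metric_sym.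
rewrite (bigD1 j)//= [X in _ + X]big1 ?addr0.
  under eq_bigr do rewrite mulrAC.
  by rewrite -mulr_suml VG eqxx mul1r.
move=> k kj; under eq_bigr do rewrite mulrAC.
by rewrite -mulr_suml VG eq_sym (negbTE kj) mul0r.
Qed.

(** For [a] and [b] both equal to the normal form, nullity thus means that the raised normal lies in
    the kernel of the form. *)
Lemma form_product_raise a b : form_product g a b = a (raise g b).
Proof.
rewrite linear_sum; apply: eq_bigr => i _; rewrite linearZ /= mulr_suml.
by apply: eq_bigr => j _; rewrite mulrAC.
Qed.

Lemma metric_nondegenerate u : (forall v, g p u v = 0) -> u = 0.
Proof.
move=> u0; have cp := chart_at_dom p; apply: (tangent_inj cp).
apply: (can_inj (mulmxK (gram_unit cp))); rewrite mul0mx.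
apply/rowP => j; rewrite [RHS]mxE.
rewrite -(u0 (coord_vec (chart_at p) p j)) -(metric_gram _ _ cp).
by rewrite tcomp_coord_vec// trmx_delta -colE [RHS]mxE.
Qed.

End Musical.

Section Hypersurface.
Context {R : realType} {n : nat} {M : C3_manifold R n}.
Variables (Sigma : set M).

(** The curve is the straight line through [c p] with velocity [tcomp v c], pulled back to [M]; its
    last coordinate stays 0. *)
Lemma slice_tangent (c : coords M) (p : M) (v : tangent p) :
  (forall q, chart_dom c q -> (Sigma q <-> c q 0 ord_max = 0)) ->
  chart_dom c p -> Sigma p -> tcomp v c 0 ord_max = 0 -> tangent_to Sigma v.
Proof.
move=> slice cp Sp v0.
pose line (t : R) : 'rV[R]_n.+1 := t *: tcomp v c + c p.
have line0 : line 0 = c p by rewrite /line scale0r add0r.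
have line_cont : {for 0, continuous line}.
  by apply: cvgD; [apply: cvgZr_tmp; exact: cvg_id|exact: cvg_cst].
exists (fun t => chart_inv c (line t)); split.
- by rewrite line0 chart_mapK.
- apply: continuous_comp => //; rewrite line0.
  by apply: chart_inv_continuous; exists p.
(* The slice condition speaks only of points of the chart domain; the chart image is open, so it
   contains the line for small [t]. *)
- have : \forall t \near 0, (c @` chart_dom c) (line t).
    by apply: line_cont; rewrite line0; exact: chart_image_nbhs.
  apply: filterS => t [q cq qt]; rewrite -qt chart_mapK//; apply/slice => //.
  rewrite qt !mxE v0 mulr0 add0r; exact/slice.
(* In [d] the curve reads [transition c d] along the line, so its velocity is the one given by the
   transformation law. *)
- move=> d dp; rewrite (tcomp_transition v cp dp).
  have dcd : differentiable (transition c d) (c p).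
    by apply: transition_differentiable => //; exact: svalP.
  have /derivableP/is_derive_line := diff_derivable (v := tcomp v c) dcd.
  by rewrite deriveE.
Qed.

Hypothesis hSigma : hypersurface Sigma.
Variables (N : forall p : M, {scalar tangent p}).
Hypothesis hN : normal_form Sigma N.

Lemma tangent_to_ker (p : M) (v : tangent p) :
  Sigma p -> (tangent_to Sigma v <-> N p v = 0).
Proof.
move=> Sp; have [[u Nu] Ntan] := hN Sp; split; first exact: Ntan.
move=> Nv; have [c cp slice] := hSigma Sp.
pose e := coord_vec c p ord_max.
have e1 : tcomp e c 0 ord_max = 1 by rewrite tcomp_coord_vec// mxE !eqxx.
(* Subtracting the multiple of [e] removes the last component and leaves a tangent vector, which
   [N p] kills. *)
have Ntrans w : N p w = tcomp w c 0 ord_max * N p e.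
  apply/eqP; rewrite -subr_eq0 -[_ * _]linearZ -linearB; apply/eqP/Ntan.
  by apply: (slice_tangent slice cp Sp); rewrite !mxE e1 mulr1 subrr.
apply: (slice_tangent slice cp Sp).
(* If [N p e] were 0, then [N p] would vanish on [u] too. *)
move/eqP: Nv; rewrite Ntrans mulf_eq0 => /orP[/eqP //|/eqP Ne].
by rewrite Ntrans Ne mulr0 eqxx in Nu.
Qed.

Lemma null_unique_degeneration (g : lorentzian_metric M) (p : M) :
  Sigma_0 g Sigma N p ->
  unique_degeneration_direction g Sigma (raise g (N p)).
Proof.
move=> [Sp null]; have [[u Nu] _] := hN Sp.
have xT : tangent_to Sigma (raise g (N p)).
  by apply/tangent_to_ker => //; rewrite -form_product_raise.
split=> //.
  apply: contra_neq Nu => x0.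
  by rewrite -(metric_raise g) x0 Defs.metric_sym linear0.
apply/seteqP; split=> [_ [v vdeg <-]|_ [a _ <-]].
  (* The coefficient is forced by pairing [v = a *: raise g (N p)] with the transverse vector
     [u]. *)
  exists (g p (val v) u / N p u) => //; apply/eqP; rewrite -subr_eq0; apply/eqP.
  apply: (metric_nondegenerate (g := g)) => w.
  (* This is the projection of [w] onto the kernel of [N p] along [u]; [v] is orthogonal to it. *)
  have wT : tangent_to Sigma (w - (N p w / N p u) *: u).
    apply/tangent_to_ker => //.
    by rewrite linearB linearZ /= divfK// subrr.
  have := vdeg (SigSub (mem_set wT)); rewrite /first_fundamental_form /=.
  move=> /eqP; rewrite linearB linearZ /= subr_eq0 => /eqP vw.
  rewrite Defs.metric_sym linearB linearZ /= !(Defs.metric_sym g w) metric_raise.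
  by rewrite vw mulrC mulrA mulrAC subrr.
have axT : tangent_to Sigma (a *: raise g (N p)).
  apply/tangent_to_ker => //.
  by rewrite linearZ /= -form_product_raise null mulr0.
exists (SigSub (mem_set axT)) => //= w.
rewrite /first_fundamental_form /= Defs.metric_sym linearZ /=.
rewrite Defs.metric_sym metric_raise.
have /tangent_to_ker -> // := set_mem (valP w).
by rewrite mulr0.
Qed.

End Hypersurface.

Theorem lemma1 (R : realType) (n : nat) (M : C3_manifold R n)
    (g : lorentzian_metric M) (Sigma : set M)
    (N : forall p : M, {scalar tangent p})
    (hSigma : hypersurface Sigma) (hN : normal_form Sigma N) :
  (forall p : M, Sigma_0 g Sigma N p ->
     unique_degeneration_direction g Sigma (raise g (N p))) /\
  (forall p : M, signature_changing g Sigma N p ->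
     unique_degeneration_direction g Sigma (raise g (N p))).
Proof.
(* Both pieces of the signature-changing set lie in [Sigma_0]. *)
by split=> p; [|case=> -[_]]; exact: null_unique_degeneration.
Qed.
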